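(* Let $\mathbf X=\mathbf U+\mathbf E\in\mathbb R^{n\times p}$, where each row $\mathbf U_{i\cdot}$ is one of $m$ fixed centers $\mathcal C=(\mathbf c_1,\dots,\mathbf c_m)$ (selected according to membership probabilities $\mathbf p$), and the rows $\mathbf E_{i\cdot}$ of $\mathbf E$ are independent, mean zero, with sub-Gaussian norm $\|\mathbf E_{i\cdot}\|_{\psi_2}=\sigma_p$. Let $\boldsymbol\Phi\in\mathbb R^{n\times n}$ be a symmetric matrix that is, almost surely, the adjacency matrix of a valid affinity graph $G=(V,\mathcal E)$, and let $\mathbf F$ be an oriented edge-incidence matrix of $G$. Let $\hat{\mathbf U}$ be the global minimizer of $$\mathbf V\mapsto \gamma\sum_{i<j}\sqrt{\Phi_{ij}}\,\|\mathbf V_{i\cdot}-\mathbf V_{j\cdot}\|_2+\tfrac12\|\mathbf V-\mathbf X\|_F^2,\qquad \mathbf V\in\mathbb R^{n\times p}.$$ If $\gamma\ge\sqrt p\,\|\mathbf F^\dagger\mathbf E\|_{\max}$, then $$\frac{1}{2np}\|\mathbf U-\hat{\mathbf U}\|_F^2\le c_1\sigma_p^2\Big(\frac1n+\frac{\log(np)}{np}\Big)+\frac{2\gamma}{np}\sum_{(i,j)\in\mathcal E}\sqrt{\Phi_{ij}}\,\|\mathbf U_{i\cdot}-\mathbf U_{j\cdot}\|_2$$ with probability at least $1-\frac{1}{np}$, where $c_1>0$ is some universal constant and $\mathbf F^\dagger$ is the Moore–Penrose pseudoinverse of $\mathbf F$.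
   Context: The sub-Gaussian norm of a random vector $\mathbf Y\in\mathbb R^p$ is $\|\mathbf Y\|_{\psi_2}=\sup_{\|\mathbf v\|_2=1}\inf\{K>0:\mathbb E[\exp((\mathbf v^\top\mathbf Y)^2/K^2)]\le2\}$. A valid affinity graph $G=(V,\mathcal E)$ on the $n$ samples is undirected, connected, has nonnegative edge weights and no self-loops; its adjacency matrix $\boldsymbol\Phi$ is symmetric with nonnegative entries and zero diagonal, node $i$ corresponds to sample $i$, and $(i,j)\in\mathcal E$ (with $i<j$) iff $\Phi_{ij}>0$. An oriented edge-incidence matrix $\mathbf F\in\mathbb R^{n\times|\mathcal E|}$ has, for each edge $(j,k)$ with $j<k$ and column index $\mathcal E(j,k)$, exactly two nonzero entries $\mathbf F_{j,\mathcal E(j,k)}=-\mathbf F_{k,\mathcal E(j,k)}=\sqrt{\Phi_{jk}}$. $\|\cdot\|_{\max}$ denotes the maximum absolute entry. *)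

(* Defs.v *)
From HB Require Import structures.
From mathcomp Require Import all_boot all_order all_algebra.
From mathcomp Require Import all_classical all_reals all_analysis.
Set Implicit Arguments. Unset Strict Implicit. Unset Printing Implicit Defensive.
Import Order.TTheory GRing.Theory Num.Theory.
Import numFieldNormedType.Exports.
Local Open Scope classical_set_scope.
Local Open Scope ring_scope.

Section Defs.
Context {R : realType}.

Definition l2norm {p : nat} (v : 'rV[R]_p) : R := Num.sqrt (\sum_(k < p) v ord0 k ^+ 2).

Definition frob2 {n p : nat} (A : 'M[R]_(n, p)) : R :=
  \sum_(i < n) \sum_(j < p) A i j ^+ 2.

Definition maxnorm {n p : nat} (A : 'M[R]_(n, p)) : R :=
  \big[Num.max/0]_(i < n) \big[Num.max/0]_(j < p) `|A i j|.

Definition adj_rel {n : nat} (Phi : 'M[R]_n) : rel 'I_n := fun i j => 0 < Phi i j.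

Definition valid_affinity_graph {n : nat} (Phi : 'M[R]_n) : Prop :=
  Phi^T = Phi /\ (forall i j, 0 <= Phi i j) /\ (forall i, Phi i i = 0) /\
  (forall i j, connect (adj_rel Phi) i j).

Definition oriented_incidence {n k : nat} (Phi : 'M[R]_n) (F : 'M[R]_(n, k)) : Prop :=
  exists ed : 'I_k -> 'I_n * 'I_n,
    injective ed /\
    (forall c, ((ed c).1 < (ed c).2)%N /\ 0 < Phi (ed c).1 (ed c).2) /\
    (forall j l : 'I_n, (j < l)%N -> 0 < Phi j l -> exists c, ed c = (j, l)) /\
    (forall i c, F i c =
       if i == (ed c).1 then Num.sqrt (Phi (ed c).1 (ed c).2)
       else if i == (ed c).2 then - Num.sqrt (Phi (ed c).1 (ed c).2)
       else 0).

Definition moore_penrose {n k : nat} (F : 'M[R]_(n, k)) (Fd : 'M[R]_(k, n)) : Prop :=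
  F *m Fd *m F = F /\ Fd *m F *m Fd = Fd /\
  (F *m Fd)^T = F *m Fd /\ (Fd *m F)^T = Fd *m F.

Definition cvx_clust_obj {n p : nat} (gamma : R) (Phi : 'M[R]_n) (X V : 'M[R]_(n, p)) : R :=
  gamma * (\sum_(i < n) \sum_(j < n | (i < j)%N)
             Num.sqrt (Phi i j) * l2norm (row i V - row j V))
  + 2^-1 * frob2 (V - X).

Definition edge_penalty {n p : nat} (Phi : 'M[R]_n) (V : 'M[R]_(n, p)) : R :=
  \sum_(i < n) \sum_(j < n | (i < j)%N && (0 < Phi i j))
     Num.sqrt (Phi i j) * l2norm (row i V - row j V).

Context {d : measure_display} {T : measurableType d}.

Definition subg_norm (P : probability T R) {p : nat} (Y : T -> 'rV[R]_p) : \bar R :=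
  ereal_sup [set ereal_inf [set (K%:E)%E | K in [set K : R | 0 < K /\
      (\int[P]_w ((expR ((v *m (Y w)^T) ord0 ord0 ^+ 2 / K ^+ 2))%:E) <= 2%:E)%E]]
    | v in [set v : 'rV[R]_p | l2norm v = 1]].

Definition gen_sigma {p : nat} (Y : T -> 'rV[R]_p) : set (set T) :=
  <<s [set S | exists (j : 'I_p) (B : set R), measurable B /\
                 S = (fun w => Y w ord0 j) @^-1` B] >>.

Definition indep_rows (P : probability T R) {n p : nat} (E : T -> 'M[R]_(n, p)) : Prop :=
  forall (J : {set 'I_n}) (A : 'I_n -> set T),
    (forall i, i \in J -> gen_sigma (fun w => row i (E w)) (A i)) ->
    P (\big[setI/setT]_(i in J) A i) = (\prod_(i in J) P (A i))%E.

End Defs.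

(* Main.v *)
(* Comparing the objective at Uhat and at U gives, with D = Uhat - U,
     1/2 |D|^2 <= <D, E> + gamma (pen U - pen Uhat).
   On a connected graph 1 - F F^+ is the averaging matrix J/n, so <D, E> splits as
   <F^T D, F^+ E> + <D, J E>/n. The first term is at most
   sqrt p |F^+ E|_max pen D <= gamma (pen U + pen Uhat). The penalty ignores translations, so
   Uhat and X have the same column sums and the second term equals |S|^2/n, where S is the sum
   of the rows of E. Hence 1/2 |D|^2 <= |S|^2/n + 2 gamma pen U.
   By independence every <v, S> with |v| <= 1 satisfies E exp(s <v, S>) <= exp(2 n s^2 sigma^2);
   a union bound over a net of at most exp(6p) points of the unit ball then gives
   |S|^2 <= 32 n sigma^2 (6p + log(np)) with probability at least 1 - 1/(np). *)
Require Import Defs.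
From HB Require Import structures.
From mathcomp Require Import all_boot all_order all_algebra.
From mathcomp Require Import all_classical all_reals all_analysis.
From mathcomp Require Import measurable_realfun ring lra.
Set Implicit Arguments. Unset Strict Implicit. Unset Printing Implicit Defensive.
Import Order.TTheory GRing.Theory Num.Theory.
Import numFieldNormedType.Exports.
Local Open Scope classical_set_scope.
Local Open Scope ring_scope.

(** * Euclidean norm of rows and Frobenius inner product *)

Section Euclidean.
Context {R : realType}.

Lemma l2norm_ge0 {p : nat} (v : 'rV[R]_p) : 0 <= l2norm v.
Proof. exact: sqrtr_ge0. Qed.

Lemma sqr_l2norm {p : nat} (v : 'rV[R]_p) :
  l2norm v ^+ 2 = \sum_(k < p) v ord0 k ^+ 2.
Proof. by rewrite sqr_sqrtr// sumr_ge0// => k _; exact: sqr_ge0. Qed.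

Lemma l2norm_eq0 {p : nat} (v : 'rV[R]_p) : l2norm v = 0 -> v = 0.
Proof.
move=> v0; apply/rowP => k; rewrite mxE.
have := sqr_l2norm v; rewrite v0 expr0n/= => /esym/eqP.
rewrite psumr_eq0; last by move=> i _; exact: sqr_ge0.
by move=> /allP/(_ k (mem_index_enum _))/=; rewrite sqrf_eq0 => /eqP.
Qed.

Lemma l2normZ {p : nat} (a : R) (v : 'rV[R]_p) : l2norm (a *: v) = `|a| * l2norm v.
Proof.
rewrite /l2norm -sqrtr_sqr -sqrtrM ?sqr_ge0// mulr_sumr.
by congr Num.sqrt; apply: eq_bigr => k _; rewrite mxE exprMn.
Qed.

(** Termwise weighted AM-GM: with a = |u| and b = |v|, each product is at most (b/a u_k^2 + a/b
    v_k^2) / 2, and these bounds sum to a b. The zero vectors, where the weights degenerate, are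
    treated first. *)
Lemma cauchy_schwarz_l2norm {p : nat} (u v : 'rV[R]_p) :
  \sum_(k < p) u ord0 k * v ord0 k <= l2norm u * l2norm v.
Proof.
have [/l2norm_eq0 ->|u0] := eqVneq (l2norm u) 0.
  by rewrite big1 ?mulr_ge0 ?l2norm_ge0// => k _; rewrite mxE mul0r.
have [/l2norm_eq0 ->|v0] := eqVneq (l2norm v) 0.
  by rewrite big1 ?mulr_ge0 ?l2norm_ge0// => k _; rewrite mxE mulr0.
have up : 0 < l2norm u by rewrite lt0r u0 l2norm_ge0.
have vp : 0 < l2norm v by rewrite lt0r v0 l2norm_ge0.
set a := l2norm u in up *; set b := l2norm v in vp *.
have -> : a * b = \sum_(k < p) (b / a * u ord0 k ^+ 2 + a / b * v ord0 k ^+ 2) / 2.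
  rewrite -mulr_suml big_split/= -!mulr_sumr -!sqr_l2norm -/a -/b.
  by field; rewrite ?(gt_eqF up) ?(gt_eqF vp).
apply: ler_sum => k _.
rewrite -subr_ge0; set x := u _ _; set y := v _ _.
have -> : (b / a * x ^+ 2 + a / b * y ^+ 2) / 2 - x * y
   = (b * x - a * y) ^+ 2 / (2 * a * b).
  by field; rewrite ?(gt_eqF up) ?(gt_eqF vp).
by rewrite divr_ge0 ?sqr_ge0// !mulr_ge0// ltW.
Qed.

Lemma l2normB {p : nat} (u v : 'rV[R]_p) : l2norm (u - v) <= l2norm u + l2norm v.
Proof.
rewrite -(@ler_pXn2r _ 2) ?nnegrE ?addr_ge0 ?l2norm_ge0//.
rewrite sqrrD !sqr_l2norm.
have -> : \sum_(k < p) (u - v) ord0 k ^+ 2 = \sum_(k < p) u ord0 k ^+ 2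
    + (\sum_(k < p) u ord0 k * (- v) ord0 k) *+ 2 + \sum_(k < p) v ord0 k ^+ 2.
  rewrite -sumrMnl -!big_split/=; apply: eq_bigr => k _.
  by rewrite !mxE; ring.
rewrite lerD2r lerD2l lerMn2r/= (le_trans (cauchy_schwarz_l2norm _ _))//.
by rewrite -scaleN1r l2normZ normrN1 mul1r.
Qed.

(** Source of the factor sqrt p in the condition on [gamma]. *)
Lemma l2norm_row_le_maxnorm {n p : nat} (M : 'M[R]_(n, p)) (i : 'I_n) :
  l2norm (row i M) <= Num.sqrt p%:R * maxnorm M.
Proof.
have Mi j : `|M i j| <= maxnorm M.
  apply: le_trans (le_bigmax_cond _ _ (isT : predT i)) => /=.
  exact: (le_trans _ (le_bigmax_cond _ _ (isT : predT j))).
have M0 : 0 <= maxnorm M by exact: bigmax_ge_id.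
rewrite -(@ler_pXn2r _ 2) ?nnegrE ?mulr_ge0 ?sqrtr_ge0 ?l2norm_ge0//.
rewrite sqr_l2norm exprMn sqr_sqrtr//.
have -> : p%:R * maxnorm M ^+ 2 = \sum_(j < p) maxnorm M ^+ 2.
  by rewrite sumr_const card_ord mulr_natl.
apply: ler_sum => j _; rewrite mxE -real_normK ?num_real//.
by rewrite ler_pXn2r ?nnegrE.
Qed.

Definition frob_inner {n p : nat} (A B : 'M[R]_(n, p)) : R :=
  \sum_(i < n) \sum_(j < p) A i j * B i j.

Lemma frob_innerE {n p : nat} (A B : 'M[R]_(n, p)) : frob_inner A B = \tr (A^T *m B).
Proof.
rewrite /frob_inner exchange_big; apply: eq_bigr => j _.
by rewrite mxE; apply: eq_bigr => i _; rewrite mxE.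
Qed.

Lemma frob_innerDr {n p : nat} (A B C : 'M[R]_(n, p)) :
  frob_inner A (B + C) = frob_inner A B + frob_inner A C.
Proof. by rewrite !frob_innerE mulmxDr mxtraceD. Qed.

Lemma frob_inner_mulmx {n k p : nat} (A : 'M[R]_(n, p)) (F : 'M[R]_(n, k)) (B : 'M[R]_(k, p)) :
  frob_inner A (F *m B) = frob_inner (F^T *m A) B.
Proof. by rewrite !frob_innerE trmx_mul trmxK mulmxA. Qed.

Lemma frob2B {n p : nat} (A B : 'M[R]_(n, p)) :
  frob2 (A - B) = frob2 A - 2 * frob_inner A B + frob2 B.
Proof.
rewrite /frob2 /frob_inner mulr_sumr -sumrB -big_split/=; apply: eq_bigr => i _.
rewrite mulr_sumr -sumrB -big_split/=; apply: eq_bigr => j _.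
by rewrite !mxE; ring.
Qed.

End Euclidean.

(** * Edge penalty, incidence matrix and the projection [F *m Fd] *)

Section GraphPenalty.
Context {R : realType} {n : nat}.
Implicit Types Phi : 'M[R]_n.

(** Reconciles the sum over edges with the sum over all pairs in the objective: a pair that is no
    edge has weight 0. *)
Lemma edge_penaltyE {p} Phi (V : 'M[R]_(n, p)) : (forall i j, 0 <= Phi i j) ->
  edge_penalty Phi V = \sum_(i < n) \sum_(j < n | (i < j)%N)
     Num.sqrt (Phi i j) * l2norm (row i V - row j V).
Proof.
move=> Phi0; apply: eq_bigr => i _; rewrite big_mkcondr/=.
apply: eq_bigr => j _; case: ifPn => //; rewrite -leNgt => Pij.
by rewrite ler0_sqrtr// mul0r.
Qed.

Lemma edge_penaltyB {p} Phi (V W : 'M[R]_(n, p)) :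
  edge_penalty Phi (V - W) <= edge_penalty Phi V + edge_penalty Phi W.
Proof.
rewrite /edge_penalty -big_split/=; apply: ler_sum => i _.
rewrite -big_split/=; apply: ler_sum => j _.
rewrite -mulrDr ler_wpM2l ?sqrtr_ge0//.
have -> : row i (V - W) - row j (V - W) = (row i V - row j V) - (row i W - row j W).
  by apply/rowP => l; rewrite !mxE; ring.
exact: l2normB.
Qed.

Lemma incidence_trmx_mul {p k : nat} Phi (F : 'M[R]_(n, k)) (ed : 'I_k -> 'I_n * 'I_n)
    (V : 'M[R]_(n, p)) c :
  (ed c).1 != (ed c).2 ->
  (forall i, F i c =
       if i == (ed c).1 then Num.sqrt (Phi (ed c).1 (ed c).2)
       else if i == (ed c).2 then - Num.sqrt (Phi (ed c).1 (ed c).2)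
       else 0) ->
  row c (F^T *m V) =
  Num.sqrt (Phi (ed c).1 (ed c).2) *: (row (ed c).1 V - row (ed c).2 V).
Proof.
move=> ne FE; apply/rowP => j; rewrite !mxE.
rewrite (bigD1 (ed c).1)//= (bigD1 (ed c).2) 1?eq_sym//= big1 => [|i /andP[i1 i2]].
  rewrite !mxE !FE eqxx eq_sym (negbTE ne) eqxx; ring.
by rewrite mxE FE (negbTE i1) (negbTE i2) mul0r.
Qed.

(** Duality between the penalty and a maximum over edges: F moves to the other side of the inner
    product, where the rows of [F^T *m V] are the weighted differences along edges, and
    Cauchy-Schwarz applies row by row. *)
Lemma oriented_incidence_inner_le {p k : nat} Phi (F : 'M[R]_(n, k))
    (V : 'M[R]_(n, p)) (M : 'M[R]_(k, p)) :
  oriented_incidence Phi F ->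
  frob_inner V (F *m M) <= Num.sqrt p%:R * maxnorm M * edge_penalty Phi V.
Proof.
case=> ed [ed_inj [ed_edge [ed_surj FE]]].
pose w x := Num.sqrt (Phi x.1 x.2) * l2norm (row x.1 V - row x.2 V).
(* [ed] is a bijection from the columns of F onto the edges. *)
have -> : edge_penalty Phi V = \sum_c w (ed c).
  rewrite /edge_penalty pair_big_dep/=.
  rewrite (eq_bigl (fun x => x \in ed @: 'I_k)).
    by rewrite big_imset//=; exact: in2W.
  move=> [i j]/=; apply/idP/imsetP => [/andP[ij Pij]|[c _ ijE]].
    by have [c edc] := ed_surj _ _ ij Pij; exists c.
  by have [] := ed_edge c; rewrite -ijE/= => -> ->.
rewrite frob_inner_mulmx mulr_sumr; apply: ler_sum => c _.
have [lt_c Phi_c] := ed_edge c.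
have ne : (ed c).1 != (ed c).2 by apply: contraTneq lt_c => ->; rewrite ltnn.
have -> : \sum_(j < p) (F^T *m V) c j * M c j =
    \sum_(j < p) row c (F^T *m V) ord0 j * row c M ord0 j.
  by apply: eq_bigr => j _; congr (_ * _); rewrite [RHS]mxE.
apply: le_trans (cauchy_schwarz_l2norm _ _) _.
rewrite (incidence_trmx_mul _ ne (FE^~ c)) l2normZ ger0_norm ?sqrtr_ge0//.
by rewrite mulrC ler_wpM2r ?l2norm_row_le_maxnorm// mulr_ge0 ?sqrtr_ge0 ?l2norm_ge0.
Qed.

(* A matrix annihilated by F^T is constant along edges, hence along the whole connected
   graph; so the orthogonal projection 1 - F F^+ is the averaging matrix. *)
Lemma connected_proj_incidence {k : nat} Phi (F : 'M[R]_(n, k)) (Fd : 'M[R]_(k, n)) :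
  valid_affinity_graph Phi -> oriented_incidence Phi F -> moore_penrose F Fd ->
  F *m Fd = 1%:M - const_mx n%:R^-1.
Proof.
move=> [Phi_sym [Phi0 [Phi_diag Phi_conn]]] [ed [_ [ed_edge [ed_surj FE]]]].
move=> [FFdF [_ [FFd_sym _]]].
set Q := 1%:M - F *m Fd.
suff QE : Q = const_mx n%:R^-1 by rewrite -QE /Q; apply/matrixP => i j; rewrite !mxE; ring.
have Q_sym i j : Q i j = Q j i.
  by rewrite -[in LHS](_ : Q^T = Q) ?mxE// /Q linearB/= FFd_sym trmx1.
have FQ : F^T *m Q = 0.
  rewrite -[F^T *m Q]trmxK trmx_mul trmxK (_ : Q^T = Q); last first.
    by apply/matrixP => i j; rewrite mxE Q_sym.
  by rewrite /Q mulmxBl mul1mx FFdF subrr trmx0.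
have row_edge_lt (i j l : 'I_n) : (i < j)%N -> 0 < Phi i j -> Q i l = Q j l.
  move=> ij Pij; have [c edc] := ed_surj _ _ ij Pij.
  have ne : (ed c).1 != (ed c).2 by rewrite edc/= -(inj_eq val_inj)/= ltn_eqF.
  have := congr1 (row c) FQ.
  rewrite (incidence_trmx_mul _ ne (FE^~ c)) edc/= => /rowP/(_ l)/eqP.
  rewrite !mxE mulf_eq0 sqrtr_eq0 leNgt Pij/= subr_eq0 => /eqP; exact.
have row_edge i j l : adj_rel Phi i j -> Q i l = Q j l.
  rewrite /adj_rel => Pij; case: (ltngtP i j) => [ij|ji|/val_inj ij].
  - exact: row_edge_lt.
  - by apply/esym/row_edge_lt => //; rewrite -Phi_sym mxE.
  - by rewrite ij.
have row_cst i j l : Q i l = Q j l.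
  have /connectP[s] := Phi_conn i j.
  elim: s i => [i _ ->//|a s IH i /= /andP[ia pa] jE].
  by rewrite (row_edge _ _ _ ia) (IH a).
have Q_cst i j i' j' : Q i j = Q i' j' by rewrite (row_cst i i') Q_sym (row_cst j j') Q_sym.
(* The two entries of each column of F cancel, so the all-ones row is fixed by Q. Every column of Q
   thus sums to 1, which identifies the constant as 1/n. *)
have oneF : (const_mx 1 : 'rV[R]_n) *m F = 0.
  apply/rowP => c; rewrite !mxE.
  have [lt_c _] := ed_edge c.
  have ne : (ed c).1 != (ed c).2 by apply: contraTneq lt_c => ->; rewrite ltnn.
  rewrite (bigD1 (ed c).1)//= (bigD1 (ed c).2) 1?eq_sym//= big1 => [|i /andP[i1 i2]].
    rewrite !mxE !FE eqxx eq_sym (negbTE ne) eqxx; ring.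
  by rewrite mxE FE (negbTE i1) (negbTE i2) mulr0.
apply/matrixP => i j; rewrite [RHS]mxE.
have : ((const_mx 1 : 'rV[R]_n) *m Q) ord0 j = 1.
  by rewrite /Q mulmxBr mulmx1 mulmxA oneF mul0mx subr0 mxE.
rewrite mxE (eq_bigr (fun=> Q i j)) => [|l _]; last by rewrite mxE mul1r (Q_cst l j i j).
rewrite sumr_const card_ord -[Q i j *+ n]mulr_natr => Qn.
have n0 : n%:R != 0 :> R.
  by apply/eqP => n0; move: Qn; rewrite n0 mulr0 => /eqP; rewrite eq_sym oner_eq0.
by apply: (mulIf n0); rewrite Qn mulVf.
Qed.

End GraphPenalty.

(** * Deterministic error bound for the minimizer *)

Section ConvexClustering.
Context {R : realType} {n p : nat}.
Variables (gamma : R) (Phi : 'M[R]_n) (U E Uhat : 'M[R]_(n, p)).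
Hypothesis n_gt0 : (0 < n)%N.
Hypothesis Phi_valid : valid_affinity_graph Phi.
Hypothesis Uhat_min : forall V,
  cvx_clust_obj gamma Phi (U + E) Uhat <= cvx_clust_obj gamma Phi (U + E) V.

Let objE (V X : 'M[R]_(n, p)) : cvx_clust_obj gamma Phi X V =
  gamma * edge_penalty Phi V + 2^-1 * frob2 (V - X).
Proof. by rewrite edge_penaltyE//; case: Phi_valid => _ []. Qed.

(* The penalty is invariant under translation of all the rows by a common vector. *)
Lemma cvx_clust_colsum (j : 'I_p) : \sum_i (Uhat - U) i j = \sum_i E i j.
Proof.
set W := Uhat - (U + E).
(* Every row of [delta] is the mean row of W, the best translation. Subtracting it lowers the
   squared norm by 1/n times the sum of the squared column sums of W, so minimality forces these
   sums to vanish. *)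
pose delta : 'M[R]_(n, p) := \matrix_(i, j) (n%:R^-1 * \sum_l W l j).
have deltaE i l : delta i l = n%:R^-1 * \sum_a W a l by rewrite mxE.
have nR : n%:R != 0 :> R by rewrite pnatr_eq0 -lt0n.
have penE : edge_penalty Phi (Uhat - delta) = edge_penalty Phi Uhat.
  apply: eq_bigr => a _; apply: eq_bigr => b _; congr (_ * l2norm _).
  by apply/rowP => l; rewrite !mxE; ring.
have := Uhat_min (Uhat - delta); rewrite !objE penE lerD2l.
rewrite (_ : Uhat - delta - _ = W - delta); last by rewrite /W addrAC.
rewrite -/W ler_pM2l ?invr_gt0// frob2B -addrA lerDl.
have -> : - (2 * frob_inner W delta) + frob2 delta =
    - \sum_l n%:R^-1 * (\sum_i W i l) ^+ 2.
  rewrite /frob2 /frob_inner mulr_sumr -sumrN -big_split/=.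
  under eq_bigr do rewrite mulr_sumr -sumrN -big_split/=.
  rewrite exchange_big/= -sumrN; apply: eq_bigr => l _.
  under eq_bigr do rewrite deltaE.
  set s := \sum_(i < n) W i l.
  rewrite big_split/= sumrN -!mulr_sumr -mulr_suml -/s sumr_const card_ord -[s *+ n]mulr_natl.
  by field.
rewrite oppr_ge0 => le0.
have : \sum_l n%:R^-1 * (\sum_i W i l) ^+ 2 == 0.
  rewrite eq_le le0/= sumr_ge0// => l _.
  by rewrite mulr_ge0 ?sqr_ge0// invr_ge0.
rewrite psumr_eq0 => [/allP/(_ j (mem_index_enum _))/=|l _]; last first.
  by rewrite mulr_ge0 ?sqr_ge0// invr_ge0.
rewrite mulf_eq0 invr_eq0 (negbTE nR)/= sqrf_eq0 => /eqP Wj.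
apply/eqP; rewrite -subr_eq0 -sumrB -[X in _ == X]Wj; apply/eqP/eq_bigr => i _.
by rewrite !mxE; ring.
Qed.

Lemma cvx_clust_error_le {k : nat} (F : 'M[R]_(n, k)) (Fd : 'M[R]_(k, n)) :
  oriented_incidence Phi F -> moore_penrose F Fd ->
  Num.sqrt p%:R * maxnorm (Fd *m E) <= gamma ->
  2^-1 * frob2 (U - Uhat) <=
    n%:R^-1 * \sum_j (\sum_i E i j) ^+ 2 + 2 * gamma * edge_penalty Phi U.
Proof.
move=> incF mpF gamma_ge.
set D := Uhat - U.
have frobD : frob2 (U - Uhat) = frob2 D.
  by apply: eq_bigr => i _; apply: eq_bigr => j _; rewrite !mxE; ring.
have basic : 2^-1 * frob2 D <=
    frob_inner D E + gamma * (edge_penalty Phi U - edge_penalty Phi Uhat).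
  have := Uhat_min U; rewrite !objE.
  rewrite (_ : Uhat - (U + E) = D - E); last by rewrite /D opprD addrA.
  rewrite (_ : U - (U + E) = 0 - E); last by rewrite opprD addrA subrr.
  rewrite !frob2B.
  have -> : frob2 (0 : 'M[R]_(n, p)) = 0.
    by apply: big1 => i _; apply: big1 => j _; rewrite mxE expr0n.
  have -> : frob_inner (0 : 'M[R]_(n, p)) E = 0.
    by apply: big1 => i _; apply: big1 => j _; rewrite mxE mul0r.
  lra.
have innerE : frob_inner D E <=
    gamma * (edge_penalty Phi U + edge_penalty Phi Uhat) +
    n%:R^-1 * \sum_j (\sum_i E i j) ^+ 2.
  have pen0 (V : 'M[R]_(n, p)) : 0 <= edge_penalty Phi V.
    do 2 apply: sumr_ge0 => ? _; exact: mulr_ge0 (sqrtr_ge0 _) (l2norm_ge0 _).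
  have FFd := connected_proj_incidence Phi_valid incF mpF.
  have EE : E = F *m (Fd *m E) + (const_mx n%:R^-1 : 'M[R]_n) *m E.
    by rewrite mulmxA FFd mulmxBl mul1mx subrK.
  rewrite [X in frob_inner _ X]EE frob_innerDr; apply: lerD.
    apply: le_trans (oriented_incidence_inner_le _ _ incF) _.
    apply: ler_pM => //; first by rewrite mulr_ge0 ?sqrtr_ge0// bigmax_ge_id.
    by rewrite addrC edge_penaltyB.
  rewrite le_eqVlt; apply/orP; left; apply/eqP.
  rewrite /frob_inner exchange_big mulr_sumr; apply: eq_bigr => j _ /=.
  rewrite (eq_bigr (fun i => D i j * (n%:R^-1 * \sum_l E l j))); last first.
    by move=> i _; congr (_ * _); rewrite mxE mulr_sumr; apply: eq_bigr => l _; rewrite mxE.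
  by rewrite -mulr_suml cvx_clust_colsum; ring.
(* On adding [basic] and [innerE] the penalties of [Uhat] cancel and that of U doubles. *)
rewrite frobD.
lra.
Qed.

End ConvexClustering.

(** * Elementary inequalities for the exponential *)

Section ExpInequalities.
Context {R : realType}.
Implicit Types x y t a : R.

(** If x > 1, then x <= 2 x^2. Otherwise 1 + y <= exp y at y = -x/2, squared, gives exp x (1 -
    x/2)^2 <= 1, and 1 + x + 2 x^2 dominates (1 - x/2)^-2 because the polynomial difference factors
    as x^2 (1 - x) (5/4 - x/2). *)
Lemma expR_le_addsqr x : expR x <= x + expR (2 * x ^+ 2).
Proof.
have [x1|x1] := leP x 1; last first.
  rewrite (@le_trans _ _ (expR (2 * x ^+ 2)))//; last by rewrite lerDr; lra.
  by rewrite ler_expR; nra.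
set e := expR (x / 2).
have ex : expR x = e ^+ 2 by rewrite /e -expRM_natl; congr expR; field.
have e_le : e * (1 - x / 2) <= 1.
  rewrite -[leRHS](expRxMexpNx_1 (x / 2)) -/e ler_wpM2l ?expR_ge0//.
  exact: expR_ge1Dx.
have e0 : 0 < e by exact: expR_gt0.
have h : 0 < 1 - x / 2 by lra.
rewrite ex; apply: (@le_trans _ _ (x + (1 + 2 * x ^+ 2))); last first.
  by rewrite lerD2l expR_ge1Dx.
rewrite -(@ler_pM2r _ ((1 - x / 2) ^+ 2)) ?exprn_gt0// -exprMn.
apply: (@le_trans _ _ 1).
  by rewrite exprn_ile1// mulr_ge0// ltW.
rewrite -subr_ge0.
have -> : (x + (1 + 2 * x ^+ 2)) * (1 - x / 2) ^+ 2 - 1 =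
   x ^+ 2 * ((1 - x) * (5 / 4 - x / 2)) by field.
rewrite mulr_ge0 ?sqr_ge0// mulr_ge0//; lra.
Qed.

(** Convexity between 0 and y: the tangent at t y lies below the exponential at both endpoints, and
    the two inequalities are averaged with weights 1 - t and t. *)
Lemma expR_chord t y : 0 <= t <= 1 -> expR (t * y) <= 1 - t + t * expR y.
Proof.
move=> /andP[t0 t1].
have e1 : expR y = expR (t * y) * expR ((1 - t) * y).
  by rewrite -expRD; congr expR; ring.
have e2 : 1 = expR (t * y) * expR (- (t * y)) by rewrite expRxMexpNx_1.
have h1 : expR (t * y) * (1 + (1 - t) * y) <= expR y.
  by rewrite [leRHS]e1 ler_wpM2l ?expR_ge0 ?expR_ge1Dx.
have h2 : expR (t * y) * (1 - t * y) <= 1.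
  by rewrite [leRHS]e2 ler_wpM2l ?expR_ge0 ?expR_ge1Dx.
have := ler_wpM2l t0 h1.
have t1' : 0 <= 1 - t by lra.
have := ler_wpM2l t1' h2.
set e := expR (t * y); lra.
Qed.

End ExpInequalities.

(** * From the psi2 condition to a moment generating function bound *)

Section MomentGeneratingFunction.
Local Open Scope ereal_scope.
Context {R : realType} d (T : measurableType d) (P : probability T R).

(** Integrates a pointwise majorant: the term in Z vanishes by centering and the exponential term
    costs at most 2c. Both ranges of s in the next lemma use it. *)
Lemma integral_expR_le (Z Y : T -> R) (s a b c : R) :
  measurable_fun setT Z -> measurable_fun setT Y ->
  P.-integrable setT (EFin \o Z) -> \int[P]_w (Z w)%:E = 0 ->
  \int[P]_w (expR (Y w))%:E <= 2%:E -> (0 <= c)%R ->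
  (forall w, expR (s * Z w) <= a + b * Z w + c * expR (Y w))%R ->
  \int[P]_w (expR (s * Z w))%:E <= (a + 2 * c)%:E.
Proof.
move=> mZ mY iZ Z0 Y2 c0 le.
have mE (f : T -> R) : measurable_fun setT f -> measurable_fun setT (EFin \o (expR \o f)).
  by move=> mf; apply/measurable_EFinP; exact: measurableT_comp.
have iY : P.-integrable setT (EFin \o (expR \o Y)).
  apply/integrableP; split; first exact: mE.
  under eq_integral do rewrite /= ger0_norm ?expR_ge0//.
  exact: le_lt_trans Y2 (ltry _).
have ia : P.-integrable setT (EFin \o cst a) by exact: finite_measure_integrable_cst.
have ib : P.-integrable setT (fun w => b%:E * (EFin \o Z) w) by exact: integrableZl.
have ic : P.-integrable setT (fun w => c%:E * (EFin \o (expR \o Y)) w) by exact: integrableZl.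
apply: (@le_trans _ _ (\int[P]_w ((EFin \o cst a) w + b%:E * (EFin \o Z) w
    + c%:E * (EFin \o (expR \o Y)) w))).
  apply: ge0_le_integral => //.
  - by apply/measurable_EFinP; apply: measurableT_comp => //; exact: measurable_funM.
  - by apply: (measurable_int P); apply: integrableD => //; exact: integrableD.
  - by move=> w _ /=; rewrite -!EFinM -!EFinD lee_fin.
rewrite integralD//; last exact: integrableD.
rewrite integralD// !integralZl// Z0 mule0 adde0.
have -> : \int[P]_w (EFin \o cst a) w = a%:E.
  rewrite -[RHS]mule1 -[X in _ = _ * X](probability_setT P).
  exact: (integral_cst P measurableT a%:E).
rewrite EFinD leeD2l//.
by rewrite mulrC EFinM lee_wpmul2l ?lee_fin.
Qed.

(* Centering makes the linear term of expR_le_addsqr integrate to 0; for large s the square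
   is completed instead. *)
Lemma mgf_le_of_psi2 (Z : T -> R) (K s : R) : (0 < K)%R ->
  measurable_fun setT Z ->
  P.-integrable setT (EFin \o Z) -> \int[P]_w (Z w)%:E = 0 ->
  \int[P]_w (expR (Z w ^+ 2 / K ^+ 2))%:E <= 2%:E ->
  \int[P]_w (expR (s * Z w))%:E <= (expR (2 * s ^+ 2 * K ^+ 2))%:E.
Proof.
move=> K0 mZ iZ Z0 psi.
have mY : measurable_fun setT (fun w => Z w ^+ 2 / K ^+ 2)%R.
  by apply: measurable_funM => //; exact: measurable_funX.
set a := (s * K)%R.
have KE (z : R) : (s * z = a * (z / K))%R by rewrite /a; field; lra.
have aE : (2 * s ^+ 2 * K ^+ 2 = 2 * a ^+ 2)%R by rewrite /a; ring.
have [a1|a1] := leP (2 * a ^+ 2)%R 1%R.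
(* The chord with t = 2 a^2 <= 1 bounds exp(2 a^2 u^2); the total is 1 + 2 a^2 <= exp(2 a^2). *)
- have : \int[P]_w (expR (s * Z w))%:E <= ((1 - 2 * a ^+ 2) + 2 * (2 * a ^+ 2))%:E.
    apply: (integral_expR_le (b := s) mZ mY) => //.
      by rewrite mulr_ge0 ?sqr_ge0.
    move=> w; rewrite KE -expr_div_n; set u := (Z w / K)%R.
    apply: le_trans (expR_le_addsqr _) _.
    have : (0 <= 2 * a ^+ 2 <= 1)%R by rewrite a1 mulr_ge0 ?sqr_ge0.
    have -> : (2 * (a * u) ^+ 2 = 2 * a ^+ 2 * u ^+ 2)%R by ring.
    by move=> /(expR_chord (u ^+ 2)); lra.
  move=> /le_trans; apply; rewrite lee_fin aE.
  by apply: le_trans (expR_ge1Dx _); lra.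
(* Here a u <= a^2/2 + u^2/2, and the chord with t = 1/2 gives 3/2 exp(a^2/2). Since 3/2 <= exp(1/2)
   and 2 a^2 > 1, this is below exp(2 a^2). *)
- have : \int[P]_w (expR (s * Z w))%:E <=
     (expR (a ^+ 2 / 2) / 2 + 2 * (expR (a ^+ 2 / 2) / 2))%:E.
    apply: (integral_expR_le (b := 0) mZ mY) => //.
    move=> w; rewrite KE -expr_div_n; set u := (Z w / K)%R.
    apply: (@le_trans _ _ (expR (a ^+ 2 / 2) * expR (2^-1 * u ^+ 2))%R).
      rewrite -expRD ler_expR.
      have := sqr_ge0 (a - u); nra.
    have : (0 <= (2^-1 : R) <= 1)%R by lra.
    move=> /(expR_chord (u ^+ 2)) h.
    have := ler_wpM2l (expR_ge0 (a ^+ 2 / 2)) h.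
    lra.
  move=> /le_trans; apply; rewrite lee_fin aE.
  apply: (@le_trans _ _ (expR (a ^+ 2 / 2) * expR 2^-1)%R).
    have := ler_wpM2l (expR_ge0 (a ^+ 2 / 2)) (expR_ge1Dx (2^-1 : R)).
    lra.
  by rewrite -expRD ler_expR; lra.
Qed.

End MomentGeneratingFunction.

(** * Factorization of integrals under independence *)

Section Independence.
Local Open Scope ereal_scope.
Context {R : realType} d (T : measurableType d) (P : probability T R).

Import HBNNSimple.

Lemma integral_indic_comp (Z : T -> R) (B : set R) :
  measurable_fun setT Z -> measurable B ->
  \int[P]_w (\1_B (Z w))%:E = P (Z @^-1` B).
Proof.
move=> mZ mB; rewrite -[in RHS](setIT (Z @^-1` B)) -(@integral_indic _ _ _ P _ measurableT)//.
by rewrite -[X in measurable X]setTI; exact: mZ.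
Qed.

(** The identity passes from indicators to simple functions by linearity, and to nonnegative
    measurable [phi] by monotone convergence. *)
Lemma ge0_integral_comp_mul (Z : T -> R) (g : T -> R) (phi : R -> R) (c : \bar R) :
  measurable_fun setT Z -> measurable_fun setT g -> (forall w, 0 <= g w)%R ->
  measurable_fun setT phi -> (forall x, 0 <= phi x)%R -> c \is a fin_num ->
  (forall B, measurable B -> \int[P]_w (\1_B (Z w) * g w)%:E = c * P (Z @^-1` B)) ->
  \int[P]_w (phi (Z w) * g w)%:E = c * \int[P]_w (phi (Z w))%:E.
Proof.
move=> mZ mg g0 mphi phi0 cfin H.
have mEphi : measurable_fun setT (EFin \o phi) by exact/measurable_EFinP.
pose h := nnsfun_approx measurableT mEphi.
have mhZ n : measurable_fun setT (h n \o Z) by exact: measurableT_comp.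
have mhZg n : measurable_fun setT (fun w => h n (Z w) * g w)%R.
  exact: measurable_funM (mhZ n) mg.
have hphi x : (EFin \o h^~ x) @ \oo --> (phi x)%:E.
  by apply: (cvg_nnsfun_approx measurableT mEphi) => // y _; rewrite lee_fin.
have ndh x a b : (a <= b)%N -> (h a x <= h b x)%R.
  by move=> ab; exact/lefP/nd_nnsfun_approx.
have -> : \int[P]_w (phi (Z w))%:E = limn (fun n => \int[P]_w (h n (Z w))%:E).
  rewrite -monotone_convergence//=.
  - by apply: eq_integral => w _; apply/esym/cvg_lim => //; exact: hphi.
  - by move=> n; apply/measurable_EFinP; exact: mhZ.
  - by move=> n w _; rewrite lee_fin.
  - by move=> w _ a b ab; rewrite lee_fin ndh.
have -> : \int[P]_w (phi (Z w) * g w)%:E = limn (fun n => \int[P]_w (h n (Z w) * g w)%:E).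
  rewrite -monotone_convergence//=.
  - apply: eq_integral => w _; apply/esym/cvg_lim => //.
    under eq_fun do rewrite EFinM.
    by rewrite EFinM; apply: cvgeZr => //; exact: hphi.
  - by move=> n; apply/measurable_EFinP; exact: mhZg.
  - by move=> n w _; rewrite lee_fin mulr_ge0.
  - by move=> w _ a b ab; rewrite lee_fin ler_wpM2r// ndh.
have mI n (y : R) : measurable (h n @^-1` [set y]).
  by apply: measurable_funPTI; exact: measurable_set1.
have mIZ n (y : R) : measurable_fun setT (fun w => \1_(h n @^-1` [set y]) (Z w) : R)%R.
  exact: measurableT_comp.
have y0 n (y : R) : y \in range (h n) -> (0 <= y)%R by rewrite inE => -[x _ <-].
rewrite -limeMl//; last first.
  apply: ereal_nondecreasing_is_cvgn => a b ab; apply: ge0_le_integral => //.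
  - by move=> w _; rewrite lee_fin.
  - by apply/measurable_EFinP; exact: mhZ.
  - by apply/measurable_EFinP; exact: mhZ.
  - by move=> w _; rewrite lee_fin ndh.
congr (limn _); apply/funext => n.
transitivity (\int[P]_w \sum_(y \in range (h n)) (y * \1_(h n @^-1` [set y]) (Z w) * g w)%:E).
  apply: eq_integral => w _; rewrite fsumEFin// fimfunE.
  by rewrite !fsbig_finite//= mulr_suml.
transitivity (c * \int[P]_w \sum_(y \in range (h n))
    (y * \1_(h n @^-1` [set y]) (Z w))%:E); last first.
  by congr (_ * _); apply: eq_integral => w _; rewrite fsumEFin// -fimfunE.
rewrite !ge0_integral_fsum//; last 4 first.
- move=> y; apply/measurable_EFinP; exact: measurable_funM.
- by move=> y w _; exact: nnfun_muleindic_ge0.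
- move=> y; apply/measurable_EFinP; apply: measurable_funM => //; exact: measurable_funM.
- by move=> y w _; rewrite EFinM mule_ge0 //; [exact: nnfun_muleindic_ge0|rewrite lee_fin].
rewrite ge0_mule_fsumr; last first.
  by move=> y; apply: integral_ge0 => w _; exact: nnfun_muleindic_ge0.
apply: eq_fsbigr => y /y0 yge0.
under eq_integral do rewrite -mulrA EFinM.
rewrite ge0_integralZl//; last 2 first.
- by apply/measurable_EFinP; exact: measurable_funM.
- by move=> w _; rewrite lee_fin mulr_ge0.
under [in RHS]eq_integral do rewrite EFinM.
rewrite ge0_integralZl//; last exact/measurable_EFinP.
rewrite H// muleCA; congr (_ * (_ * _)).
by rewrite integral_indic_comp.
Qed.

(** The factors change from indicators to [phi] one index at a time: in [f k B] the first k factors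
    are already [phi]. The base case k = 0 is independence of the events. *)
Lemma integral_prod_comp_indep (n : nat) (Z : 'I_n -> T -> R) (phi : 'I_n -> R -> R) :
  (forall i, measurable_fun setT (Z i)) ->
  (forall i, measurable_fun setT (phi i)) -> (forall i x, 0 <= phi i x)%R ->
  (forall i, \int[P]_w (phi i (Z i w))%:E < +oo) ->
  (forall B : 'I_n -> set R, (forall i, measurable (B i)) ->
    P (\big[setI/setT]_i (Z i @^-1` B i)) = \prod_i P (Z i @^-1` B i)) ->
  \int[P]_w (\prod_i phi i (Z i w))%:E = \prod_i \int[P]_w (phi i (Z i w))%:E.
Proof.
move=> mZ mphi phi0 phi_fin indep.
pose f (k : nat) (B : 'I_n -> set R) (i : 'I_n) : R -> R :=
  if (i < k)%N then phi i else \1_(B i).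
have mf k B i : (forall i, measurable (B i)) -> measurable_fun setT (f k B i).
  by rewrite /f => mB; case: ifP.
have f0 k B i x : (0 <= f k B i x)%R by rewrite /f; case: ifP.
suff main k B : (k <= n)%N -> (forall i, measurable (B i)) ->
    \int[P]_w (\prod_i f k B i (Z i w))%:E = \prod_i \int[P]_w (f k B i (Z i w))%:E.
  have := main n (fun=> setT) (leqnn n) (fun=> measurableT).
  rewrite /f; under eq_integral do under eq_bigr do rewrite ltn_ord.
  by move=> ->; apply: eq_bigr => i _; rewrite ltn_ord.
elim: k B => [|k IH] B kn mB.
  rewrite /f/=; under [RHS]eq_bigr do rewrite integral_indic_comp//.
  rewrite -indep// -[in RHS](setIT (\big[_/_]_i _)).
  rewrite -(@integral_indic _ _ _ P _ measurableT); last first.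
    apply: bigsetI_measurable => i _.
    by rewrite -[X in measurable X]setTI; exact: mZ.
  apply: eq_integral => w _; congr EFin.
  elim/big_rec2 : _ => [|i x S _ ->]; first by rewrite indicT.
  by rewrite indicI.
pose i0 := Ordinal kn.
have eqf (C : set R) i : i != i0 -> f k.+1 B i = f k (fun i => if i == i0 then C else B i) i.
  move=> ii0; rewrite /f (negbTE ii0) ltnS leq_eqVlt.
  by rewrite -[(i : nat) == k]/(i == i0) (negbTE ii0).
under eq_integral do rewrite (bigD1 i0)//=.
rewrite [RHS](bigD1 i0)//= muleC.
have fi0 : f k.+1 B i0 = phi i0 by rewrite /f /= ltnSn.
rewrite fi0.
apply: (ge0_integral_comp_mul (Z := Z i0) (phi := phi i0)
  (g := fun w => \prod_(i < n | i != i0) f k.+1 B i (Z i w))%R) => //.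
- under eq_fun do rewrite big_mkcond/=.
  apply: (measurable_prod (h := fun i w => if i != i0 then f k.+1 B i (Z i w) else 1%R)) => i _.
  by case: (i != i0) => //; apply: measurableT_comp => //; exact: mf.
- by move=> w; apply: prodr_ge0.
- apply: prode_fin_num => i _; rewrite ge0_fin_numE; last first.
    by apply: integral_ge0 => w _; rewrite lee_fin.
  rewrite /f; case: ifP => _ //; rewrite integral_indic_comp//.
  by rewrite (le_lt_trans (probability_le1 _ _)) ?ltry// -[X in measurable X]setTI; exact: mZ.
(* The induction hypothesis holds for all families B, so the set at index [i0] can be an arbitrary
   C; this supplies the identity on indicators. *)
move=> C mC; pose B' i := if i == i0 then C else B i.
have mB' i : measurable (B' i) by rewrite /B'; case: ifP.
have := IH B' (ltnW kn) mB'.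
rewrite [X in _ = X -> _](bigD1 i0)//= [f k B' i0]/f ltnn /B' eqxx.
rewrite integral_indic_comp// muleC.
rewrite [X in _ = X * _ -> _](eq_bigr (fun i => \int[P]_w (f k.+1 B i (Z i w))%:E)); last first.
  by move=> i ii0; rewrite -(eqf C).
move=> <-; apply: eq_integral => w _; rewrite [in RHS](bigD1 i0)//=.
rewrite [f k _ i0]/f ltnn eqxx; congr (_ * _)%:E.
by apply: eq_bigr => i ii0; rewrite (eqf C).
Qed.

End Independence.

(** * A finite net of the unit ball *)

Section SphereNet.
Context {R : realType} {p : nat}.

(** Magnitudes up to 4p suffice, since j^2 <= 4p forces j <= 4p. A zero coordinate has two codes,
    which is harmless for an upper bound on the cardinality. *)
Notation code := {ffun 'I_p -> bool * 'I_(4 * p).+1}.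

Definition code_sqnorm (k : code) : nat := \sum_i (k i).2 ^ 2.

(* Sign-magnitude coding of the lattice points of (2 sqrt p)^-1 Z^p in the unit ball. *)
Definition net_point (k : code) : 'rV[R]_p :=
  \row_i ((-1) ^+ (k i).1 * (k i).2%:R / (2 * Num.sqrt p%:R)).

Definition net : {set code} := [set k | (code_sqnorm k <= 4 * p)%N]%SET.

(** Comparison with the geometric series of ratio 1/2, by j <= j^2 and exp(-1) <= 1/2. *)
Lemma sum_expR_sqr_le (N : nat) : \sum_(j < N) expR (- (j%:R ^+ 2) : R) <= 2.
Proof.
have e1 : expR (-1) <= (2^-1 : R).
  rewrite expRN lef_pV2 ?posrE ?expR_gt0//.
  by apply: le_trans (expR_ge1Dx _); lra.
apply: (@le_trans _ _ (\sum_(j < N) (2^-1 : R) ^+ j)).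
  apply: ler_sum => j _; apply: (@le_trans _ _ (expR (-1) ^+ j)).
    rewrite -expRM_natl ler_expR mulrN1 lerN2 -natrX ler_nat.
    by case: (nat_of_ord j) => // m; rewrite expnS leq_pmulr ?expn_gt0.
  by apply: lerXn2r => //; rewrite nnegrE ?expR_ge0.
suff -> : \sum_(j < N) (2^-1 : R) ^+ j = 2 - 2 * 2^-1 ^+ N.
  by rewrite lerBlDr lerDl mulr_ge0// exprn_ge0.
elim: N => [|N IH]; first by rewrite big_ord0 expr0; lra.
by rewrite big_ord_recr/= IH exprS; field.
Qed.

(* Each lattice point of squared norm at most 4p is weighted by the product over its
   coordinates of exp (4 - j^2) >= 1, and the weights factor over the coordinates. *)
Lemma card_net_le : #|net|%:R <= expR (6 * p%:R : R).
Proof.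
rewrite -sum1_card natr_sum.
pose f (x : bool * 'I_(4 * p).+1) : R := expR (4 - x.2%:R ^+ 2).
apply: (@le_trans _ _ (\sum_(k : code) \prod_i f (k i))).
  rewrite big_mkcond/=; apply: ler_sum => k _; case: ifPn => [|_].
    rewrite inE => kp; rewrite /f -expR_sum.
    rewrite big_split/= sumr_const card_ord sumrN.
    have sqE : \sum_i (k i).2%:R ^+ 2 = (code_sqnorm k)%:R :> R.
      by rewrite natr_sum; apply: eq_bigr => i _; rewrite natrX.
    apply: (@le_trans _ _ (expR 0)); first by rewrite expR0.
    by rewrite ler_expR sqE subr_ge0 -[4 *+ p]mulr_natr -natrM ler_nat.
  by apply: prodr_ge0 => i _; exact: expR_ge0.
rewrite -(bigA_distr_bigA (fun=> f)) prodr_const card_ord mulrC expRM_natl.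
apply: lerXn2r; rewrite ?nnegrE ?expR_ge0//.
  by apply: sumr_ge0 => x _; exact: expR_ge0.
rewrite -(pair_big predT predT (fun b j => f (b, j)))/= big_bool/=.
have fE b : \sum_(j < (4 * p).+1) f (b, j) <= expR 4 * 2.
  apply: le_trans (ler_wpM2l (expR_ge0 4) (sum_expR_sqr_le (4 * p).+1)).
  by rewrite mulr_sumr; apply: ler_sum => j _; rewrite /f expRD.
apply: le_trans (lerD (fE true) (fE false)) _.
(* Two signs times the series bound 2 give a factor 4 <= exp 2 per coordinate, hence the exponent 6
   = 4 + 2. *)
have -> : (6 : R) = 4 + (1 + 1) by lra.
rewrite -mulrDr [leRHS]expRD ler_wpM2l ?expR_ge0// expRD.
by have := expR_ge1Dx (1 : R); nra.
Qed.

Lemma l2norm_net_point (k : code) : k \in net -> l2norm (net_point k) <= 1.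
Proof.
rewrite inE => kp.
case: (posnP p) => [p0|p_gt0].
  by rewrite /l2norm big1 ?sqrtr0// => -[i ip]; exfalso; move: (ip); rewrite p0.
have pR : 0 < p%:R :> R by rewrite ltr0n.
rewrite -(@ler_pXn2r _ 2) ?nnegrE ?sqrtr_ge0// expr1n.
rewrite sqr_sqrtr; last by apply: sumr_ge0 => i _; exact: sqr_ge0.
rewrite (eq_bigr (fun i => ((k i).2 ^ 2)%:R / (4 * p%:R))); last first.
  move=> i _; rewrite mxE expr_div_n !exprMn sqrr_sign mul1r sqr_sqrtr// natrX.
  by congr (_ / (_ * _)); rewrite -natrX.
rewrite -mulr_suml -natr_sum ler_pdivrMr ?mulr_gt0// mul1r -natrM ler_nat//.
Qed.

(** The vector 2 sqrt p y / r is rounded towards zero in each coordinate: the result stays in the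
    ball, and rounding costs at most half of r in the inner product with y. *)
Lemma net_approx (y : 'I_p -> R) (r : R) : (0 < p)%N -> 0 < r ->
  \sum_i y i ^+ 2 = r ^+ 2 ->
  exists2 k, k \in net & r / 2 <= \sum_i net_point k ord0 i * y i.
Proof.
move=> p_gt0 r0 yr.
have pR : 0 < p%:R :> R by rewrite ltr0n.
pose q : R := Num.sqrt p%:R.
have q0 : 0 < q by rewrite sqrtr_gt0.
have qq : q ^+ 2 = p%:R by rewrite sqr_sqrtr// ltW.
pose x i := 2 * q * `|y i| / r.
have x0 i : 0 <= x i by rewrite /x !mulr_ge0// ?invr_ge0 ltW.
pose a i := Num.truncn (x i).
have ax i : (a i)%:R <= x i by rewrite truncn_le.
have xa i : x i < (a i)%:R + 1.
  by have /andP[_] := truncn_itv (x0 i); rewrite -natr1.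
have sumx : \sum_i x i ^+ 2 = (4 * p)%:R.
  rewrite (eq_bigr (fun i => 4 * q ^+ 2 / r ^+ 2 * y i ^+ 2)).
    by rewrite -mulr_sumr yr qq natrM; field; rewrite gt_eqF.
    move=> i _; rewrite /x expr_div_n exprMn real_normK ?num_real// exprMn.
    by field; rewrite gt_eqF.
have suma : (\sum_i a i ^ 2 <= 4 * p)%N.
  rewrite -(@ler_nat R) -sumx natr_sum; apply: ler_sum => i _.
  by rewrite natrX ler_pXn2r ?nnegrE.
have alt i : (a i < (4 * p).+1)%N.
  rewrite ltnS; apply: leq_trans suma; rewrite (bigD1 i)//=.
  apply: leq_trans (leq_addr _ _).
  by case: (a i) => // m; rewrite expnS leq_pmulr ?expn_gt0.
exists [ffun i => (y i < 0, Ordinal (alt i))].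
  by rewrite inE /code_sqnorm (eq_bigr (fun i => (a i ^ 2)%N))// => i _; rewrite ffunE.
(* The loss |y_i| / (2 sqrt p) in coordinate i is replaced by its AM-GM bound (y_i^2/r + r/p) / 4.
   These bounds sum to r/2, the main terms to r. *)
apply: (@le_trans _ _ (\sum_i (`|y i| ^+ 2 / r - (`|y i| ^+ 2 / r + r / p%:R) / 4))).
  rewrite sumrB -!mulr_suml big_split/= -mulr_suml sumr_const card_ord -mulr_natr.
  rewrite (eq_bigr (fun i => y i ^+ 2)); last by move=> i _; rewrite real_normK ?num_real.
  by rewrite yr le_eqVlt; apply/orP; left; apply/eqP; field; rewrite !gt_eqF.
apply: ler_sum => i _; rewrite mxE ffunE/= -/q.
have -> : (-1) ^+ (y i < 0)%R * (a i)%:R / (2 * q) * y i = (a i)%:R * `|y i| / (2 * q).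
  have [y0|y0] := ltP (y i) 0; first by rewrite (ltr0_norm y0) expr1; ring.
  by rewrite (ger0_norm y0) expr0; ring.
pose z : R := `|y i|.
have z0 : 0 <= z by exact: normr_ge0.
apply: (@le_trans _ _ ((x i - 1) * z / (2 * q))); last first.
  have q2 : 0 <= (2 * q)^-1 by rewrite invr_ge0 mulr_ge0// ltW.
  rewrite (ler_wpM2r q2)// (ler_wpM2r z0)//.
  by rewrite lerBlDr ltW.
rewrite /x -/z -subr_ge0 -qq.
have -> : (2 * q * z / r - 1) * z / (2 * q) -
    (z ^+ 2 / r - (z ^+ 2 / r + r / q ^+ 2) / 4) = (z - r / q) ^+ 2 / (4 * r).
  by field; rewrite !gt_eqF.
by rewrite divr_ge0 ?sqr_ge0// mulr_ge0// ltW.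
Qed.

End SphereNet.

(** * Linear forms of one sub-Gaussian vector *)

Section SubGaussianVector.
Local Open Scope ereal_scope.
Context {R : realType} d (T : measurableType d) (P : probability T R) (p : nat).
Implicit Types (Y : T -> 'rV[R]_p) (v : 'rV[R]_p).

Lemma measurable_linear_form Y v : (forall j, measurable_fun setT (fun w => Y w ord0 j)) ->
  measurable_fun setT (fun w => \sum_j v ord0 j * Y w ord0 j)%R.
Proof.
move=> mY; apply: measurable_sum => j.
by apply: measurable_funM => //; exact: measurable_cst.
Qed.

(** Transfers [indep_rows], stated on generated sigma-algebras, to linear forms of the rows. *)
Lemma gen_sigma_linear_form Y v (B : set R) : measurable B ->
  gen_sigma Y ((fun w => \sum_j v ord0 j * Y w ord0 j)%R @^-1` B).
Proof.
move=> mB.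
pose G := [set S | exists (j : 'I_p) (B : set R), measurable B /\
                 S = (fun w => Y w ord0 j) @^-1` B].
have mY j : measurable_fun (setT : set (g_sigma_algebraType G)) (fun w => Y w ord0 j).
  by move=> _ C mC; rewrite setTI; apply: sub_sigma_algebra; exists j, C.
have : measurable_fun (setT : set (g_sigma_algebraType G))
    (fun w => \sum_j v ord0 j * Y w ord0 j)%R.
  apply: measurable_sum => j.
  by apply: measurable_funM => //; exact: measurable_cst.
by move=> /(_ measurableT B mB); rewrite setTI.
Qed.

Lemma integral_linear_form_eq0 Y v :
  (forall j, P.-integrable setT (fun w => (Y w ord0 j)%:E) /\
             \int[P]_w (Y w ord0 j)%:E = 0) ->
  P.-integrable setT (fun w => (\sum_j v ord0 j * Y w ord0 j)%:E) /\
  \int[P]_w (\sum_j v ord0 j * Y w ord0 j)%:E = 0.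
Proof.
move=> HY; elim: (index_enum _) => [|j s [iS iS0]].
  under eq_fun do rewrite big_nil.
  by split; [exact: integrable0|rewrite integral0].
have [iY Y0] := HY j.
have ij : P.-integrable setT (fun w => (v ord0 j)%:E * (Y w ord0 j)%:E) by exact: integrableZl.
under eq_fun do rewrite big_cons EFinD EFinM.
split; first exact: integrableD.
by rewrite integralD// integralZl// Y0 mule0 add0e.
Qed.

(** The strict inequality avoids the question whether the infimum is attained: some admissible K'
    lies below K, and the integral decreases in K. *)
Lemma subg_norm_psi2 Y v (sigma K : R) :
  (forall j, measurable_fun setT (fun w => Y w ord0 j)) ->
  subg_norm P Y = sigma%:E -> (sigma < K)%R -> l2norm v = 1%R ->
  (0 < K)%R /\
  \int[P]_w (expR ((\sum_j v ord0 j * Y w ord0 j) ^+ 2 / K ^+ 2))%:E <= 2%:E.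
Proof.
move=> mY Ysigma sK v1.
have E w : (\sum_j v ord0 j * Y w ord0 j = (v *m (Y w)^T) ord0 ord0)%R.
  by rewrite mxE; apply: eq_bigr => j _; rewrite mxE.
pose S := [set (K%:E)%E | K in [set K : R | (0 < K)%R /\
      (\int[P]_w ((expR ((v *m (Y w)^T) ord0 ord0 ^+ 2 / K ^+ 2))%:E) <= 2%:E)%E]].
have : ereal_inf S < K%:E.
  apply: (@le_lt_trans _ _ (sigma%:E)); last by rewrite lte_fin.
  by rewrite -Ysigma; apply: ereal_sup_ubound; exists v.
move=> /ereal_inf_lt[_ [K' [K'0 psi] <-]]; rewrite lte_fin => K'K.
have K0 : (0 < K)%R by exact: lt_trans K'K.
split=> //; apply: le_trans psi.
have mexp (k : R) : measurable_fun setT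
    (fun w => (expR ((\sum_j v ord0 j * Y w ord0 j) ^+ 2 / k ^+ 2))%:E).
  apply/measurable_EFinP; apply: measurableT_comp => //; apply: measurable_funM => //.
  by apply: measurable_funX; exact: measurable_linear_form.
under [leRHS]eq_integral do rewrite -E.
apply: ge0_le_integral => //.
move=> w _; rewrite lee_fin ler_expR ler_wpM2l ?sqr_ge0//.
by rewrite lef_pV2 ?posrE ?exprn_gt0// lerXn2r// ?nnegrE ltW.
Qed.

(** The psi2 norm tests unit vectors only, so v is normalized and its length, at most 1, is absorbed
    into s. *)
Lemma subg_norm_mgf_le Y v (sigma K s : R) :
  (forall j, measurable_fun setT (fun w => Y w ord0 j)) ->
  (forall j, P.-integrable setT (fun w => (Y w ord0 j)%:E) /\
             \int[P]_w (Y w ord0 j)%:E = 0) ->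
  subg_norm P Y = sigma%:E -> (sigma < K)%R -> (l2norm v <= 1)%R ->
  \int[P]_w (expR (s * \sum_j v ord0 j * Y w ord0 j))%:E <= (expR (2 * s ^+ 2 * K ^+ 2))%:E.
Proof.
move=> mY iY Ysigma sK v1.
have K2 : (0 <= 2 * s ^+ 2 * K ^+ 2)%R by rewrite mulr_ge0 ?sqr_ge0// mulr_ge0 ?sqr_ge0.
have [v0|v0] := eqVneq (l2norm v) 0%R.
  have -> : \int[P]_w (expR (s * \sum_j v ord0 j * Y w ord0 j))%:E = \int[P]_w cst 1 w.
    apply: eq_integral => w _; rewrite big1 ?mulr0 ?expR0// => j _.
    by rewrite (l2norm_eq0 v0) mxE mul0r.
  rewrite (integral_cst P measurableT 1) mul1e.
  rewrite (le_trans (probability_le1 P measurableT))// lee_fin.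
  by apply: le_trans (expR_ge1Dx _); rewrite lerDl.
have vp : (0 < l2norm v)%R by rewrite lt0r v0 l2norm_ge0.
pose u := ((l2norm v)^-1 *: v)%R.
have u1 : l2norm u = 1%R by rewrite l2normZ ger0_norm ?invr_ge0 ?mulVf// ltW.
have vu w : (s * (\sum_j v ord0 j * Y w ord0 j) =
    (s * l2norm v) * \sum_j u ord0 j * Y w ord0 j)%R.
  rewrite -mulrA; congr (_ * _)%R; rewrite mulr_sumr; apply: eq_bigr => j _.
  by rewrite mxE !mulrA mulfV// mul1r.
have [K0 psi] := subg_norm_psi2 mY Ysigma sK u1.
have [iu u0] := integral_linear_form_eq0 u iY.
under eq_integral do rewrite vu.
apply: le_trans (mgf_le_of_psi2 (s * l2norm v) K0 (measurable_linear_form u mY) iu u0 psi) _.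
rewrite lee_fin ler_expR ler_wpM2r ?sqr_ge0// ler_wpM2l// exprMn.
by rewrite -[leRHS]mulr1 ler_wpM2l ?sqr_ge0// exprn_ile1// ltW.
Qed.

End SubGaussianVector.

(** * Concentration of the sum of the rows *)

Section SubGaussianRows.
Local Open Scope ereal_scope.
Context {R : realType} d (T : measurableType d) (P : probability T R) (n p : nat).
Variables (E : T -> 'M[R]_(n, p)) (sigma : R).
Hypothesis n_gt0 : (0 < n)%N.
Hypothesis p_gt0 : (0 < p)%N.
Hypothesis mE : forall i j, measurable_fun setT (fun w => E w i j).
Hypothesis indE : indep_rows P E.
Hypothesis E_centered : forall i j, P.-integrable setT (fun w => (E w i j)%:E) /\
               (\int[P]_w (E w i j)%:E = 0).
Hypothesis E_subg : forall i, subg_norm P (fun w => row i (E w)) = sigma%:E.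

Let mrow i j : measurable_fun setT (fun w => row i (E w) ord0 j).
Proof. by under eq_fun do rewrite mxE; exact: mE. Qed.

Let row_centered i j : P.-integrable setT (fun w => (row i (E w) ord0 j)%:E) /\
               (\int[P]_w (row i (E w) ord0 j)%:E = 0).
Proof. by under eq_fun do rewrite mxE; exact: E_centered. Qed.

Lemma sum_rows_mgf_le (v : 'rV[R]_p) (K s : R) : (sigma < K)%R -> (l2norm v <= 1)%R ->
  \int[P]_w (expR (s * \sum_j v ord0 j * \sum_i E w i j))%:E <=
    (expR (2 * n%:R * s ^+ 2 * K ^+ 2))%:E.
Proof.
move=> sK v1.
pose Z i w := (\sum_j v ord0 j * row i (E w) ord0 j)%R.
have mZ i : measurable_fun setT (Z i) by exact: measurable_linear_form (mrow i).
have Zmgf i : \int[P]_w (expR (s * Z i w))%:E <= (expR (2 * s ^+ 2 * K ^+ 2))%:E.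
  exact: (subg_norm_mgf_le s (mrow i) (row_centered i) (E_subg i) sK v1).
have -> : \int[P]_w (expR (s * \sum_j v ord0 j * \sum_i E w i j))%:E =
    \int[P]_w (\prod_i expR (s * Z i w))%:E.
  apply: eq_integral => w _; rewrite -expR_sum -mulr_sumr; congr (expR (_ * _))%:E.
  rewrite exchange_big/=; apply: eq_bigr => j _; rewrite mulr_sumr.
  by apply: eq_bigr => i _; rewrite mxE.
rewrite (integral_prod_comp_indep (phi := fun=> (fun x => expR (s * x))%R) mZ)//.
- have -> : (expR (2 * n%:R * s ^+ 2 * K ^+ 2))%:E =
      \prod_(i < n) (expR (2 * s ^+ 2 * K ^+ 2))%:E.
    by rewrite prodEFin prodr_const card_ord -expRM_natl; congr (expR _)%:E; ring.
  (* Nonnegativity is part of the induction because multiplying inequalities of extended reals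
     requires it. *)
  suff /andP[//] : 0 <= \prod_i \int[P]_w (expR (s * Z i w))%:E <=
      \prod_(i < n) (expR (2 * s ^+ 2 * K ^+ 2))%:E.
  elim/big_rec2 : _ => [|i b a _ /andP[a0 ab]]; first by rewrite lexx lee01.
  have Z0 : 0 <= \int[P]_w (expR (s * Z i w))%:E by exact: integral_ge0.
  by rewrite mule_ge0//= lee_pmul.
- by move=> i; apply: measurableT_comp => //; exact: measurable_funM.
- by move=> i; apply: le_lt_trans (Zmgf i) _; exact: ltry.
- move=> B mB.
  have sZ i : i \in [set: 'I_n]%SET -> gen_sigma (fun w => row i (E w)) (Z i @^-1` B i).
    by move=> _; exact: gen_sigma_linear_form.
  have := indE sZ.
  by under eq_bigl do rewrite finset.in_setT; under [in RHS]eq_bigl do rewrite finset.in_setT.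
Qed.

(** Some row and some unit vector exist, so [sigma] bounds an infimum of positive numbers from
    above. The case K = 0 later yields [0 <= sigma]. *)
Lemma subg_norm_lt_gt0 (K : R) : (sigma < K)%R -> (0 < K)%R.
Proof.
pose i0 := Ordinal n_gt0; pose v : 'rV[R]_p := delta_mx ord0 (Ordinal p_gt0).
have v1 : l2norm v = 1%R.
  rewrite /l2norm (bigD1 (Ordinal p_gt0))//= mxE !eqxx big1 ?addr0 ?expr1n ?sqrtr1//.
  by move=> j j0; rewrite mxE (negbTE j0) andbF expr0n.
have m j : measurable_fun setT (fun w => row i0 (E w) ord0 j).
  by under eq_fun do rewrite mxE; exact: mE.
by move=> sK; case: (subg_norm_psi2 m (E_subg i0) sK v1).
Qed.

Let np : R := (n * p)%:R.
(** Logarithm of the bound on the net size plus that of the inverse failure probability. *)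
Let L : R := (6 * p%:R + ln np)%R.
Let sqS w : R := (\sum_j (\sum_i E w i j) ^+ 2)%R.

Let measurable_sqS : measurable_fun setT sqS.
Proof.
apply: measurable_sum => j; apply: measurable_funX.
by apply: measurable_sum => i; exact: mE.
Qed.

Let measurable_sqS_le a : measurable [set w | (sqS w <= a)%R].
Proof.
rewrite -[X in measurable X]setTI; apply: measurable_fun_le => //.
Qed.

Let np_ge1 : (1 <= np)%R.
Proof. by rewrite /np ler1n muln_gt0 n_gt0 p_gt0. Qed.

Let L_gt0 : (0 < L)%R.
Proof.
by rewrite /L ltr_wpDr ?ln_ge0// mulr_gt0// ltr0n.
Qed.

(* Chernoff's bound in every direction of the net at once. *)
Lemma sum_rows_sqnorm_tail (K : R) : (sigma < K)%R ->
  1 - (np^-1)%:E <= P [set w | (sqS w <= 32 * n%:R * K ^+ 2 * L)%R].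
Proof.
move=> sK; have K0 := subg_norm_lt_gt0 sK.
have nR : (0 < n%:R :> R)%R by rewrite ltr0n.
(* Threshold in one direction: the event to exclude is |S| > 2t, and the net captures half of
   |S|. *)
pose t : R := Num.sqrt (8 * n%:R * K ^+ 2 * L).
have t2 : (t ^+ 2 = 8 * n%:R * K ^+ 2 * L)%R.
  by rewrite sqr_sqrtr// ltW// !mulr_gt0// exprn_gt0.
have t0 : (0 < t)%R by rewrite sqrtr_gt0 !mulr_gt0// exprn_gt0.
(* This s minimizes 2 n s^2 K^2 - s t; the minimum is -t^2 / (8 n K^2) = -L. *)
pose s : R := (t / (4 * n%:R * K ^+ 2))%R.
have s0 : (0 < s)%R by rewrite divr_gt0// !mulr_gt0// exprn_gt0.
set A := [set w | _].
have mA : measurable A by exact: measurable_sqS_le.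
pose lf (v : 'rV[R]_p) w : R := (\sum_j v ord0 j * \sum_i E w i j)%R.
have mlf v : measurable_fun setT (lf v).
  apply: measurable_sum => j; apply: measurable_funM => //.
  by apply: measurable_sum => i; exact: mE.
suff PA : P (~` A) <= (np^-1)%:E.
  move: PA; rewrite probability_setC// leeBlDr ?fin_num_measure// => PA.
  by rewrite leeBlDr// addeC.
pose g (k : {ffun 'I_p -> bool * 'I_(4 * p).+1}) w : R := expR (s * lf (net_point k) w - s * t).
have mg k : measurable_fun setT (EFin \o g k).
  apply/measurable_EFinP; apply: measurableT_comp => //.
  by apply: measurable_funB => //; exact: measurable_funM.
have g0 k w : (0 <= g k w)%R by exact: expR_ge0.
have cover w : (~` A) w -> (1 <= \sum_(k in net) g k w)%R.
  rewrite /A /= => /negP; rewrite -ltNge => Sw.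
  pose r := Num.sqrt (sqS w).
  have sqS0 : (0 <= sqS w)%R by apply: sumr_ge0 => j _; exact: sqr_ge0.
  have r2 : (\sum_j (\sum_i E w i j) ^+ 2 = r ^+ 2)%R by rewrite sqr_sqrtr.
  have tr : (2 * t < r)%R.
    rewrite -(@ltr_pXn2r _ 2) ?nnegrE ?sqrtr_ge0 ?mulr_ge0 ?ltW//.
    by rewrite -r2 exprMn t2; move: Sw; rewrite /sqS; lra.
  have [k knet rk] := net_approx p_gt0 (lt_trans (mulr_gt0 (ltr0n R 2) t0) tr) r2.
  rewrite (bigD1 k)//=; apply: (@le_trans _ _ (g k w)); last first.
    by rewrite lerDl; apply: sumr_ge0.
  rewrite /g -expR0 ler_expR subr_ge0 ler_pM2l//.
  by apply: le_trans rk; lra.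
have -> : P (~` A) = \int[P]_w (\1_(~` A) w)%:E.
  by rewrite integral_indic ?setIT//; exact: measurableC.
apply: (@le_trans _ _ (\int[P]_w (\sum_(k <- enum net) (g k w)%:E))).
  apply: ge0_le_integral => //.
  - by apply/measurable_EFinP; apply: measurable_indic; exact: measurableC.
  - by apply: emeasurable_sum => k; exact: mg.
  - move=> w _; rewrite sumEFin lee_fin big_enum/= indicE.
    case: (boolP (w \in _)) => [/set_mem/cover//|_].
    by apply: sumr_ge0.
rewrite ge0_integral_sum//; last by move=> k w _; rewrite lee_fin.
have gint k : k \in net -> \int[P]_w (g k w)%:E <= (expR (- L))%:E.
  move=> knet.
  have -> : \int[P]_w (g k w)%:E =
      (expR (- (s * t)))%:E * \int[P]_w (expR (s * lf (net_point k) w))%:E.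
    rewrite -ge0_integralZl//.
    - by apply: eq_integral => w _; rewrite -EFinM -expRD addrC.
    - by apply/measurable_EFinP; apply: measurableT_comp => //; exact: measurable_funM.
  have h := sum_rows_mgf_le s sK (l2norm_net_point knet).
  apply: (@le_trans _ _ ((expR (- (s * t)))%:E * (expR (2 * n%:R * s ^+ 2 * K ^+ 2))%:E)).
    by rewrite lee_wpmul2l ?lee_fin ?expR_ge0.
  rewrite -EFinM lee_fin -expRD ler_expR le_eqVlt; apply/orP; left; apply/eqP.
  have -> : L = (t ^+ 2 / (8 * n%:R * K ^+ 2))%R by rewrite t2; field; rewrite !gt_eqF.
  by rewrite /s; field; rewrite !gt_eqF.
apply: (@le_trans _ _ (\sum_(k <- enum net) (expR (- L))%:E)).
  rewrite !big_seq; apply: lee_sum => k; rewrite mem_enum; exact: gint.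
rewrite sumEFin lee_fin big_enum/= sumr_const -mulr_natl.
apply: (@le_trans _ _ (expR (6 * p%:R) * expR (- L))%R).
  by rewrite ler_wpM2r ?expR_ge0// card_net_le.
by rewrite -expRD /L opprD addrA subrr sub0r expRN lnK// posrE (lt_le_trans ltr01).
Qed.

(** The tail bound requires K > sigma. The events for K = sigma + 1/(m+1) decrease to the event at
    sigma itself, and continuity from above preserves the bound. *)
Lemma sum_rows_sqnorm_le :
  1 - (np^-1)%:E <= P [set w | (sqS w <= 32 * n%:R * sigma ^+ 2 * L)%R].
Proof.
pose K (m : nat) : R := (sigma + m.+1%:R^-1)%R.
have sK m : (sigma < K m)%R by rewrite ltrDl invr_gt0.
have sigma0 : (0 <= sigma)%R.
  by rewrite leNgt; apply/negP => /subg_norm_lt_gt0; rewrite ltxx.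
have KK a b : (a <= b)%N -> (K b <= K a)%R.
  by move=> ab; rewrite lerD2l lef_pV2 ?posrE// ler_nat ltnS.
pose A (m : nat) := [set w | (sqS w <= 32 * n%:R * K m ^+ 2 * L)%R].
have Kcvg : K @ \oo --> sigma.
  rewrite -[X in _ --> X]addr0; apply: cvgD; first exact: cvg_cst.
  exact: cvg_harmonic.
have Acap : [set w | (sqS w <= 32 * n%:R * sigma ^+ 2 * L)%R] = \bigcap_m A m.
  apply/seteqP; split => w /=.
    move=> Sw m _; apply: le_trans Sw _.
    rewrite ler_wpM2r ?(ltW L_gt0)// ler_wpM2l ?mulr_ge0//.
    by rewrite lerXn2r ?nnegrE// ?(ltW (sK m))// (le_trans sigma0)// ltW.
  move=> Aw.
  have cv : (32 * n%:R * K m ^+ 2 * L)%R @[m --> \oo] --> (32 * n%:R * sigma ^+ 2 * L)%R.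
    apply: cvgMr_tmp; apply: cvgMl_tmp; exact: cvgM.
  rewrite -(cvg_lim _ cv)//; apply: limr_ge; first by apply/cvg_ex; eexists; exact: cv.
  by apply: nearW => m; exact: Aw.
have mA m : measurable (A m) by exact: measurable_sqS_le.
rewrite Acap.
have PA : (P \o A) @ \oo --> P (\bigcap_m A m).
  apply: nonincreasing_cvg_mu => //.
  - by rewrite (le_lt_trans (probability_le1 _ _)) ?ltry.
  - exact: bigcapT_measurable.
  - move=> a b ab; apply/subsetPset => w /le_trans; apply.
    rewrite ler_wpM2r ?(ltW L_gt0)// ler_wpM2l ?mulr_ge0//.
    by rewrite lerXn2r ?nnegrE ?KK// (le_trans sigma0) ?(ltW (sK _)).
rewrite -(cvg_lim _ PA)//; apply: lime_ge; first by apply/cvg_ex; eexists; exact: PA.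
by apply: nearW => m; exact: sum_rows_sqnorm_tail.
Qed.

End SubGaussianRows.

(** * Combination of the deterministic bound with the tail bound *)

Theorem theorem2p2 :
  forall R : realType, exists c1 : R, 0 < c1 /\
  forall (d : measure_display) (T : measurableType d) (P : probability T R)
         (n p m : nat),
  (0 < n)%N -> (0 < p)%N ->
  forall (C : 'M[R]_(m, p)) (pi : 'rV[R]_m),
  (forall k, 0 <= pi ord0 k) -> \sum_(k < m) pi ord0 k = 1 ->
  forall L : T -> 'I_n -> 'I_m,
  (forall i k, measurable [set w | L w i = k] /\
               P [set w | L w i = k] = (pi ord0 k)%:E) ->
  forall U : T -> 'M[R]_(n, p),
  (forall w, U w = \matrix_(i, j) C (L w i) j) ->
  forall E : T -> 'M[R]_(n, p),
  (forall i j, measurable_fun setT (fun w => E w i j)) ->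
  indep_rows P E ->
  (forall i j, P.-integrable setT (fun w => (E w i j)%:E) /\
               (\int[P]_w (E w i j)%:E = 0)%E) ->
  forall sigma : R,
  (forall i, subg_norm P (fun w => row i (E w)) = sigma%:E) ->
  forall X : T -> 'M[R]_(n, p),
  (forall w, X w = U w + E w) ->
  forall Phi : T -> 'M[R]_n,
  {ae P, forall w, valid_affinity_graph (Phi w)} ->
  forall (k : T -> nat) (F : forall w, 'M[R]_(n, k w)) (Fd : forall w, 'M[R]_(k w, n)),
  (forall w, valid_affinity_graph (Phi w) ->
     oriented_incidence (Phi w) (F w) /\ moore_penrose (F w) (Fd w)) ->
  forall (gamma : R) (Uhat : T -> 'M[R]_(n, p)),
  (forall w, valid_affinity_graph (Phi w) ->
     forall V : 'M[R]_(n, p),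
       cvx_clust_obj gamma (Phi w) (X w) (Uhat w) <= cvx_clust_obj gamma (Phi w) (X w) V) ->
  exists A : set T, measurable A /\
    ((1 - ((n * p)%:R)^-1)%:E <= P A)%E /\
    forall w, A w ->
      Num.sqrt (p%:R) * maxnorm (Fd w *m E w) <= gamma ->
      ((2 * n * p)%:R)^-1 * frob2 (U w - Uhat w)
        <= c1 * sigma ^+ 2 * (n%:R^-1 + ln ((n * p)%:R) / (n * p)%:R)
           + 2 * gamma / (n * p)%:R * edge_penalty (Phi w) (U w).
Proof.
(* 192 = 32 * 6, since 6p + log(np) <= 6 (p + log(np)). *)
move=> R; exists 192; split; first by [].
move=> d T P n p m n_gt0 p_gt0 C pi pi_ge0 pi_sum1 L L_distr U UE E mE indE E_centered
  sigma E_subg X XE Phi Phi_valid k F Fd F_incidence gamma Uhat Uhat_min.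
case: Phi_valid => N [mN PN0 subN].
have mS : measurable [set w | \sum_j (\sum_i E w i j) ^+ 2 <=
    32 * n%:R * sigma ^+ 2 * (6 * p%:R + ln (n * p)%:R)].
  rewrite -[X in measurable X]setTI; apply: measurable_fun_le => //.
  apply: measurable_sum => j; apply: measurable_funX.
  by apply: measurable_sum => i; exact: mE.
have PS := sum_rows_sqnorm_le n_gt0 p_gt0 mE indE E_centered E_subg.
set S := [set w | _] in mS PS.
(* Removing the null set N, which contains every outcome with an invalid graph, costs no
   probability. *)
exists (S `\` N); split; first exact: measurableD.
split.
  rewrite measureD//; last by rewrite (le_lt_trans (probability_le1 _ _)) ?ltry.
  rewrite [X in (_ - X)%E](_ : _ = 0%E) ?sube0//.
  by apply: (subset_measure0 _ mN _ PN0) => //; exact: measurableI.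
move=> w [Sw Nw] gamma_ge.
have valid_w : valid_affinity_graph (Phi w) by apply: contrapT => /subN.
have [incF mpF] := F_incidence w valid_w.
have min_w V : cvx_clust_obj gamma (Phi w) (U w + E w) (Uhat w) <=
    cvx_clust_obj gamma (Phi w) (U w + E w) V by rewrite -XE; exact: Uhat_min.
have := cvx_clust_error_le n_gt0 valid_w min_w incF mpF gamma_ge.
have nR : 0 < n%:R :> R by rewrite ltr0n.
have pR : 0 < p%:R :> R by rewrite ltr0n.
have npR : 0 <= (n%:R * p%:R : R)^-1 by rewrite invr_ge0 mulr_ge0// ltW.
have l0 : 0 <= ln (n * p)%:R :> R by rewrite ln_ge0// ler1n muln_gt0 n_gt0.
move: Sw; rewrite /S/= !natrM in l0 *.
set q := \sum_j _; set l := ln _ in l0 *; set f := frob2 _; set e := edge_penalty _ _.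
move=> Sq fq.
have nq : n%:R^-1 * q <= 32 * sigma ^+ 2 * (6 * p%:R + l).
  rewrite ler_pdivrMl//; apply: le_trans Sq _.
  by rewrite le_eqVlt; apply/orP; left; apply/eqP; ring.
have sl : 0 <= sigma ^+ 2 * l by rewrite mulr_ge0 ?sqr_ge0.
have fb : 2^-1 * f <= 192 * sigma ^+ 2 * (p%:R + l) + 2 * gamma * e by nra.
have -> : (2 * n%:R * p%:R)^-1 * f = (n%:R * p%:R)^-1 * (2^-1 * f).
  by field; rewrite !gt_eqF.
apply: le_trans (ler_wpM2l npR fb) _.
by rewrite le_eqVlt; apply/orP; left; apply/eqP; field; rewrite !gt_eqF.
Qed.
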